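(* Let $r \in [0,1]$ be a real number. Then, for all integers $n \geq 2$, $r$ is the upper density of an $n$-c.e. set if and only if $r$ is the upper density of a co-c.e. set.
   Context: For $X \subseteq \omega=\{0,1,2,\dots\}$ and an integer $m>0$, let $\rho_m(X) = |\{j \in X : j < m\}|/m$. The upper density of $X$ is $\overline{\rho}(X)=\limsup_m \rho_m(X)$. Sets are identified with their characteristic functions. For a natural number $n$, a set $A \subseteq \omega$ is $n$-c.e. if there is a computable function $g:\omega\times\omega\to\{0,1\}$ such that for all $x$: $g(x,0)=0$, $A(x)=\lim_s g(x,s)$, and $|\{s : g(x,s) \neq g(x,s+1)\}| \leq n$. A set is co-c.e. if its complement in $\omega$ is c.e. *)

(* Defs.v *)
From mathcomp Require Import all_boot all_order all_algebra.
From mathcomp Require Import all_classical all_reals all_analysis.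

Set Implicit Arguments.
Unset Strict Implicit.
Unset Printing Implicit Defensive.

Import Order.TTheory GRing.Theory Num.Theory.

Local Open Scope classical_set_scope.

(* Kleene's mu-recursive definitions; [murec n] denotes partial functions of
   n natural number arguments. *)
Inductive murec : nat -> Type :=
| MZero n : murec n
| MSucc : murec 1
| MProj n (i : 'I_n) : murec n
| MComp n m (f : murec m) (g : 'I_m -> murec n) : murec n
| MPrec n (f : murec n) (g : murec n.+2) : murec n.+1
| MMu n (f : murec n.+1) : murec n.

(* [computes c v y]: the partial function defined by c is defined at v, with
   value y.  In MPrec the recursion variable is the first argument:
     h (0, t) = f t,   h (k+1, t) = g (h (k, t), k, t).
   In MMu the search variable is the first argument, and all values below the
   least zero are required to be defined. *)
Fixpoint computes n (c : murec n) : n.-tuple nat -> nat -> Prop :=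
  match c in murec n return n.-tuple nat -> nat -> Prop with
  | MZero n => fun=> fun y => y = 0
  | MSucc => fun v y => y = (thead v).+1
  | MProj n i => fun v y => y = tnth v i
  | MComp n m f g => fun v y =>
      exists w : m.-tuple nat,
        (forall i, computes (g i) v (tnth w i)) /\ computes f w y
  | MPrec n f g => fun v =>
      (fix prec (k : nat) : nat -> Prop :=
         match k with
         | 0 => fun y => computes f [tuple of behead v] y
         | k'.+1 => fun y =>
             exists z, prec k' z /\
               computes g [tuple of z :: k' :: [tuple of behead v]] y
         end) (thead v)
  | MMu n f => fun v y =>
      computes f [tuple of y :: v] 0 /\
      (forall z, z < y -> exists k, computes f [tuple of z :: v] k.+1)
  end.

Definition computable1 (f : nat -> nat) : Prop :=
  exists c : murec 1, forall x, computes c [tuple x] (f x).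

Definition computable2 (f : nat -> nat -> nat) : Prop :=
  exists c : murec 2, forall x y, computes c [tuple x; y] (f x y).

Definition ce (A : set nat) : Prop :=
  A = set0 \/ exists f : nat -> nat, computable1 f /\ A = range f.

Definition co_ce (A : set nat) : Prop := ce (~` A).

(* The values 0 and 1 are the booleans, which carry the discrete topology;
   [x \in A] is the characteristic function of A. *)
Definition n_ce (n : nat) (A : set nat) : Prop :=
  exists g : nat -> nat -> bool,
    computable2 (fun x s => nat_of_bool (g x s)) /\
    forall x : nat,
      [/\ g x 0 = false,
          g x s @[s --> \oo] --> (x \in A) &
          ([set s | g x s <> g x s.+1] #<= `I_n)%card].

Local Open Scope ring_scope.

Definition rho (R : realType) (X : set nat) (m : nat) : R :=
  #|[pred j : 'I_m | (j : nat) \in X]|%:R / m%:R.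

(* The sequence is indexed by m = k + 1 > 0.  It is bounded, so that limn_sup
   is its limit superior. *)
Definition upper_density (R : realType) (X : set nat) : R :=
  limn_sup (fun k : nat => rho R X k.+1).

(* Main.v *)
Require Import Defs.
From mathcomp Require Import all_boot all_order all_algebra.
From mathcomp Require Import all_classical all_reals all_analysis.
From mathcomp Require Import zify ring lra.

(* Let [A] be n-c.e., or just the limit of a computable [g x s].  The blocks
   [bound k, bound k.+1) grow so fast that the upper density of a set spread
   evenly over each block is the limsup of its densities on the blocks.  Each
   block codes a pair (m, s), and we fill it with periodic copies of the stage
   [s] approximation to [A] below [m], provided that [s] is the last stage at
   which this approximation changes (or is 0 if it never does).  A wrong guess
   is eventually detected, by a later change, and then the block is emptied;
   hence the resulting set is co-c.e.  Every [m] has exactly one right guess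
   [s], so that the density of [A] below [m] is the density of only finitely
   many blocks, and the other blocks are empty: both sets have the same upper
   density.  Conversely every co-c.e. set is 2-c.e. *)

Set Implicit Arguments.
Unset Strict Implicit.
Unset Printing Implicit Defensive.

Import Order.TTheory GRing.Theory Num.Theory.

Local Open Scope classical_set_scope.

(** * Computable functions *)

Definition computable n (F : n.-tuple nat -> nat) : Prop :=
  exists c : murec n, forall v, computes c v (F v).

Lemma computable_ext n (F G : n.-tuple nat -> nat) :
  F =1 G -> computable F -> computable G.
Proof. by move=> FG [c cP]; exists c => v; rewrite -FG. Qed.

Lemma computable_proj n (i : 'I_n) : computable (fun v => tnth v i).
Proof. by exists (MProj i). Qed.

Lemma computable_succ n (F : n.-tuple nat -> nat) :
  computable F -> computable (fun v => (F v).+1).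
Proof.
by move=> [c cP]; exists (MComp MSucc (fun=> c)) => v; exists [tuple F v];
  split=> [i|//]; rewrite ord1.
Qed.

Lemma computable_const n a : computable (fun _ : n.-tuple nat => a).
Proof. by elim: a => [|a /computable_succ//]; exists (MZero n). Qed.

Lemma computable_comp1 (h : nat -> nat) n (F : n.-tuple nat -> nat) :
  computable1 h -> computable F -> computable (fun v => h (F v)).
Proof.
move=> [c cP] [d dP]; exists (MComp c (fun=> d)) => v; exists [tuple F v].
by split=> [i|//]; rewrite ord1.
Qed.

Lemma computable_comp2 (h : nat -> nat -> nat) n (F G : n.-tuple nat -> nat) :
  computable2 h -> computable F -> computable G ->
  computable (fun v => h (F v) (G v)).
Proof.
move=> [c cP] [d dP] [e eP]; exists (MComp c (tnth [tuple d; e])) => v.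
by exists [tuple F v; G v]; split=> [[[|[|]] // i]|//]; rewrite !(tnth_nth 0) /=.
Qed.

Lemma computable1_of_tuple (h : nat -> nat) :
  computable (fun v : 1.-tuple nat => h (tnth v ord0)) -> computable1 h.
Proof. by move=> [c cP]; exists c => x; apply: cP. Qed.

Lemma computable2_of_tuple (h : nat -> nat -> nat) :
  computable (fun v : 2.-tuple nat =>
    h (tnth v ord0) (tnth v (lift ord0 ord0))) ->
  computable2 h.
Proof. by move=> [c cP]; exists c => x y; apply: cP. Qed.

(** Primitive recursion in the form in which all later computability proofs use it: the step
    receives the previous value, the recursion variable and the parameter, in the argument order of
    [MPrec]. *)
Lemma computable2_rec (h : nat -> nat -> nat) (f : nat -> nat)
    (G : nat -> nat -> nat -> nat) :
  computable (fun v : 1.-tuple nat => f (tnth v ord0)) ->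
  computable (fun v : 3.-tuple nat =>
    G (tnth v ord0) (tnth v (lift ord0 ord0))
      (tnth v (lift ord0 (lift ord0 ord0)))) ->
  (forall y, h 0 y = f y) -> (forall k y, h k.+1 y = G (h k y) k y) ->
  computable2 h.
Proof.
move=> [c cP] [d dP] h0 hS; exists (MPrec c d).
suff H (v : 2.-tuple nat) :
    computes (MPrec c d) v (h (thead v) (thead [tuple of behead v])).
  by move=> x y; apply: (H [tuple x; y]).
rewrite /=; elim: (thead v) => [|k IH]; first by rewrite h0; exact: cP.
exists (h k (thead [tuple of behead v])); split; first exact: IH.
have := dP [tuple of h k (thead [tuple of behead v]) :: k :: [tuple of behead v]].
by rewrite hS /thead !(tnth_nth 0).
Qed.

Lemma computable1_rec (h : nat -> nat) a (G : nat -> nat -> nat) :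
  computable (fun v : 3.-tuple nat =>
    G (tnth v ord0) (tnth v (lift ord0 ord0))) ->
  h 0 = a -> (forall k, h k.+1 = G (h k) k) -> computable1 h.
Proof.
move=> cG h0 hS; have H : computable2 (fun k _ => h k).
  by apply: (computable2_rec (f := fun=> a) (G := fun a k _ => G a k)) => //;
    apply: computable_const.
apply: computable1_of_tuple.
exact: (computable_comp2 H (computable_proj _) (computable_const _ 0)).
Qed.

Lemma computable2_add : computable2 addn.
Proof.
apply: (computable2_rec (f := id) (G := fun a _ _ => a.+1)) => //.
- exact: computable_proj.
- exact/computable_succ/computable_proj.
Qed.

Lemma computable2_mul : computable2 muln.
Proof.
apply: (computable2_rec (f := fun=> 0) (G := fun a _ y => y + a)).
- exact: computable_const.
- by apply: (computable_comp2 computable2_add); apply: computable_proj.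
- exact: mul0n.
- by move=> k y; rewrite mulSn.
Qed.

Lemma computable1_pred : computable1 predn.
Proof.
apply: (computable1_rec (a := 0) (G := fun _ k => k)) => //.
exact: computable_proj.
Qed.

Lemma computable2_sub : computable2 subn.
Proof.
have H : computable2 (fun k y => y - k).
  apply: (computable2_rec (f := id) (G := fun a _ _ => a.-1)).
  - exact: computable_proj.
  - exact/(computable_comp1 computable1_pred)/computable_proj.
  - exact: subn0.
  - by move=> k y; rewrite subnS.
apply: computable2_of_tuple.
by apply: (computable_comp2 H); apply: computable_proj.
Qed.

Lemma computable_leq n (F G : n.-tuple nat -> nat) :
  computable F -> computable G -> computable (fun v => (F v <= G v) : nat).
Proof.
move=> cF cG; apply: (computable_ext (F := fun v => 1 - (F v - G v))).
  by move=> v; case: leqP => ? /=; lia.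
apply: (computable_comp2 computable2_sub); first exact: computable_const.
exact: (computable_comp2 computable2_sub).
Qed.

Lemma computable_neq n (F G : n.-tuple nat -> nat) :
  computable F -> computable G -> computable (fun v => (F v != G v) : nat).
Proof.
move=> cF cG.
apply: (computable_ext (F := fun v => (F v < G v) + (G v < F v))).
  by move=> v; case: ltngtP.
apply: (computable_comp2 computable2_add).
- exact/(computable_leq _ cG)/computable_succ.
- exact/(computable_leq _ cF)/computable_succ.
Qed.

Lemma computable_if0 n (F G H : n.-tuple nat -> nat) :
  computable F -> computable G -> computable H ->
  computable (fun v => if F v is 0 then G v else H v).
Proof.
move=> cF cG cH.
have c0 := computable_const n 0.
apply: (computable_ext (F := fun v => G v * (F v <= 0) + H v * (F v != 0))).
  by move=> v; case: (F v) => [|k] /=; rewrite !(muln0, muln1, addn0).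
apply: (computable_comp2 computable2_add);
  apply: (computable_comp2 computable2_mul) => //.
- exact: computable_leq.
- exact: computable_neq.
Qed.

Ltac computable_arith :=
  repeat lazymatch goal with
  | |- computable (fun v => tnth v _) => exact: computable_proj
  | |- computable (fun v => S (@?F v)) => apply: computable_succ
  | |- computable (fun v => addn (@?F v) (@?G v)) =>
      apply: (computable_comp2 computable2_add)
  | |- computable (fun v => muln (@?F v) (@?G v)) =>
      apply: (computable_comp2 computable2_mul)
  | |- computable (fun v => subn (@?F v) (@?G v)) =>
      apply: (computable_comp2 computable2_sub)
  | |- computable (fun v => nat_of_bool (leq (@?F v) (@?G v))) =>
      apply: computable_leq
  | |- computable (fun v => nat_of_bool (~~ (@?F v == @?G v))) =>
      apply: computable_neq
  | |- computable (fun=> _) => exact: computable_const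
  end.

(** Recursion on the dividend: the remainder goes up by one, and falls back to 0 after reaching [m].
    The successor keeps the modulus positive. *)
Lemma computable2_modS : computable2 (fun x m => x %% m.+1).
Proof.
apply: (computable2_rec (f := fun=> 0) (G := fun a _ m => a.+1 * (a != m))).
- exact: computable_const.
- computable_arith.
- by move=> m; rewrite mod0n.
- move=> x m; rewrite modnS; case: ifP => [d|nd].
    suff -> : x %% m.+1 = m by rewrite eqxx muln0.
    move: d; rewrite /dvdn -addn1 -modnDml => /eqP d.
    have := ltn_pmod x (ltn0Sn m); rewrite ltnS leq_eqVlt => /orP[/eqP//|lt].
    by move: d; rewrite addn1 modn_small.
  case: eqP => [e|_]; last by rewrite muln1.
  by move: nd; rewrite /dvdn -addn1 -modnDml e addn1 modnn.
Qed.

Lemma computable2_sum (F : nat -> nat -> nat) : computable2 F ->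
  computable2 (fun k y => \sum_(0 <= i < k) F i y).
Proof.
move=> cF.
apply: (computable2_rec (f := fun=> 0) (G := fun a k y => a + F k y)).
- exact: computable_const.
- by computable_arith; apply: (computable_comp2 cF); apply: computable_proj.
- by move=> y; rewrite big_geq.
- by move=> k y; rewrite big_nat_recr.
Qed.

Lemma computable1_fact : computable1 factorial.
Proof.
apply: (computable1_rec (a := 1) (G := fun a k => k.+1 * a)) => //.
by computable_arith.
Qed.

(* The [k] such that [h k <= x < h k.+1]. *)
Fixpoint invseq (h : nat -> nat) (x : nat) : nat :=
  if x is x'.+1 then invseq h x' + (h (invseq h x').+1 <= x) else 0.

Lemma computable1_invseq (h : nat -> nat) :
  computable1 h -> computable1 (invseq h).
Proof.
move=> ch.
apply: (computable1_rec (a := 0) (G := fun a x => a + (h a.+1 <= x.+1))) => //.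
by computable_arith; apply: (computable_comp1 ch); computable_arith.
Qed.

(** One increment per step is enough: with [k = invseq h x], the bound [x < h k.+1] gives
    [x.+1 <= h k.+1 < h k.+2]. *)
Lemma invseqP (h : nat -> nat) (x : nat) :
  h 0 = 0 -> (forall k, h k < h k.+1) ->
  h (invseq h x) <= x < h (invseq h x).+1.
Proof.
move=> h0 hS; elim: x => [|x /andP[le lt]] /=.
  by rewrite h0 -[X in X < _]h0 hS.
case: (leqP (h (invseq h x).+1)) => [le'|lt'].
  by rewrite addn1 le' /=; exact: leq_trans (hS _).
by rewrite addn0 (leqW le) lt'.
Qed.

Lemma invseq_eq (h : nat -> nat) (x k : nat) :
  h 0 = 0 -> (forall k, h k < h k.+1) -> h k <= x < h k.+1 -> invseq h x = k.
Proof.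
move=> h0 hS /andP[kx xk]; have /andP[ix xi] := invseqP x h0 hS.
have hm : {homo h : a b / a <= b}.
  by apply: homo_leq => [a|b a c|a]; [|exact: leq_trans|exact: ltnW].
case: (ltngtP (invseq h x) k) => // lt.
  by have := leq_trans xi (leq_trans (hm _ _ lt) kx); rewrite ltnn.
by have := leq_trans xk (leq_trans (hm _ _ lt) ix); rewrite ltnn.
Qed.

(** * Pairs and co-c.e. sets *)

Definition isqrt : nat -> nat := invseq (fun k => k * k).

Definition pfst (y : nat) : nat := y - isqrt y * isqrt y.

(* [y = (m + s)^2 + m] codes the pair [(m, s)]; this coding is not injective:
   since subtraction is truncated, [(m, 0)] has further codes. *)
Definition psnd (y : nat) : nat := isqrt y - pfst y.

Lemma isqrtP y : isqrt y * isqrt y <= y < (isqrt y).+1 * (isqrt y).+1.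
Proof. by apply: (@invseqP (fun k => k * k)) => // k; nia. Qed.

Lemma isqrt_ge n y : n * n <= y -> n <= isqrt y.
Proof. by have := isqrtP y; nia. Qed.

Lemma unpair_surj m s : exists y, [/\ m <= y, pfst y = m & psnd y = s].
Proof.
exists ((m + s) * (m + s) + m).
have e : isqrt ((m + s) * (m + s) + m) = m + s.
  by apply: invseq_eq => //; [move=> k; nia | nia].
by rewrite /psnd /pfst e; split; lia.
Qed.

Lemma pfst_le y : pfst y <= y.
Proof. exact: leq_subr. Qed.

Lemma computable1_isqrt : computable1 isqrt.
Proof.
apply/computable1_invseq/computable1_of_tuple.
by apply: (computable_comp2 computable2_mul); apply: computable_proj.
Qed.

Lemma computable1_pfst : computable1 pfst.
Proof.
apply: computable1_of_tuple; apply: (computable_comp2 computable2_sub).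
  exact: computable_proj.
by apply: (computable_comp2 computable2_mul);
  apply/(computable_comp1 computable1_isqrt)/computable_proj.
Qed.

Lemma computable1_psnd : computable1 psnd.
Proof.
apply: computable1_of_tuple; apply: (computable_comp2 computable2_sub).
- exact/(computable_comp1 computable1_isqrt)/computable_proj.
- exact/(computable_comp1 computable1_pfst)/computable_proj.
Qed.

(** To enumerate the complement, run through all codes of pairs [(x, t)]. Output [x] if [t] refutes
    its membership, and otherwise a fixed element [a] of the complement. *)
Lemma co_ce_Pi1 (N : nat -> nat -> nat) :
  computable2 N -> co_ce [set x | forall t, N x t = 0].
Proof.
move=> cN; rewrite /co_ce; set B := ~` _.
have BP x : B x <-> exists t, N x t <> 0.
  by rewrite /B /=; split=> [/existsNP//|[t nt]]; apply/existsNP; exists t.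
have [|/set0P[a Ba]] := eqVneq B set0; first by left.
right; exists (fun y => if N (pfst y) (psnd y) is 0 then a else pfst y).
split.
  apply/computable1_of_tuple/computable_if0;
    [apply: (computable_comp2 cN) | exact: computable_const |];
    by [apply/(computable_comp1 computable1_pfst)/computable_proj
       | apply/(computable_comp1 computable1_psnd)/computable_proj].
rewrite eqEsubset; split=> x.
  move=> /BP [t nt]; have [y [_ y1 y2]] := unpair_surj x t.
  by exists y => //; rewrite y1 y2; case: (N x t) nt.
move=> [y _ <-]; case e: (N _ _) => [//|k]; apply/BP; exists (psnd y).
by rewrite e.
Qed.

(** * The co-c.e. set attached to a limit approximation *)

(** The factorial makes all earlier blocks negligible ([bound_mul]). The factor [k] gives
    [bound 0 = 0], strict growth from the start, and [bound_sqr], which absorbs errors linear in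
    [k]. *)
Definition bound (k : nat) : nat := k * k`!.

Definition block : nat -> nat := invseq bound.

Lemma bound_lt k : bound k < bound k.+1.
Proof. by rewrite /bound factS; have := fact_gt0 k; nia. Qed.

Lemma bound_le : {homo bound : k l / k <= l}.
Proof.
by apply: homo_leq => [k|k l m|k]; [|exact: leq_trans|exact/ltnW/bound_lt].
Qed.

Lemma bound_mul k : k.+1 * bound k <= bound k.+1.
Proof. by rewrite /bound factS; have := fact_gt0 k; nia. Qed.

Lemma bound_sqr k : k * k <= bound k.
Proof. by rewrite /bound leq_mul2l fact_geq orbT. Qed.

Lemma blockP x : bound (block x) <= x < bound (block x).+1.
Proof. by apply: invseqP => //; apply: bound_lt. Qed.

Lemma block_eq k x : bound k <= x < bound k.+1 -> block x = k.
Proof. by apply: invseq_eq => //; apply: bound_lt. Qed.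

Lemma computable1_block : computable1 block.
Proof.
apply/computable1_invseq/computable1_of_tuple/(computable_comp2 computable2_mul).
  exact: computable_proj.
exact/(computable_comp1 computable1_fact)/computable_proj.
Qed.

(** At stage 0 the truncated predecessor compares [g i 0] with itself, so no change is counted
    there. *)
Definition changes (g : nat -> nat -> bool) (m s : nat) : nat :=
  \sum_(0 <= i < m) (g i s.-1 != g i s).

Lemma changes_eq0 g m s :
  changes g m s = 0 <-> forall i, i < m -> g i s.-1 = g i s.
Proof.
rewrite /changes; split=> [/eqP|H].
  rewrite sum_nat_seq_eq0 => /allP H i im; move: (H i).
  by rewrite mem_index_iota im /= eqb0 negbK => /(_ isT)/eqP.
by rewrite big_nat big1// => i /H ->; rewrite eqxx.
Qed.

Definition settles g m s :=
  (s = 0 \/ changes g m s <> 0) /\ forall t, changes g m (s + t).+1 = 0.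

(** The three terms vanish, respectively, when [s] is 0 or a stage of change, when no change occurs
    at stage [s + t + 1], and when the residue of [x] is accepted at stage [s]. Only the middle one
    depends on [t]: it is the search for a later change that empties the block. The successor in [m]
    makes the period positive. *)
Definition flaws (g : nat -> nat -> bool) (x t : nat) : nat :=
  let k := block x in
  let m := (pfst k).+1 in
  let s := psnd k in
  s * (1 - changes g m s) + changes g m (s + t).+1 + (1 - g (x %% m) s).

Definition spread (g : nat -> nat -> bool) : set nat :=
  [set x | forall t, flaws g x t = 0].

Lemma spreadP g x (k := block x) :
  spread g x <->
  settles g (pfst k).+1 (psnd k) /\ g (x %% (pfst k).+1) (psnd k).
Proof.
rewrite /spread /flaws /= -/k; split.
  move=> H; split; [split=> [|t]|].
  - by have := H 0; case: (psnd k) => [|s]; [left|right; lia].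
  - by have := H t; lia.
  - by have := H 0; case: (g _ _) => //=; lia.
move=> [[[s0|ch] H] gx] t; rewrite H gx.
  by rewrite s0 subnn.
have -> : 1 - changes g (pfst k).+1 (psnd k) = 0 by lia.
by rewrite muln0.
Qed.

Lemma computable2_flaws (g : nat -> nat -> bool) :
  computable2 (fun x s => g x s : nat) ->
  computable2 (flaws g).
Proof.
move=> cg; have cch : computable2 (changes g).
  apply: (computable2_sum (F := fun i s => g i s.-1 != g i s)).
  apply: computable2_of_tuple.
  (* The comparison of booleans is replaced by one of their numerical values, to which
     [computable_neq] applies. *)
  apply: (computable_ext (F := fun v : 2.-tuple nat =>
    (g (tnth v ord0) (tnth v (lift ord0 ord0)).-1 : nat) !=
    (g (tnth v ord0) (tnth v (lift ord0 ord0)) : nat))).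
    by move=> v; case: (g _ _); case: (g _ _).
  apply: computable_neq; apply: (computable_comp2 cg); try exact: computable_proj.
  exact/(computable_comp1 computable1_pred)/computable_proj.
have cx : computable (fun v : 2.-tuple nat => tnth v ord0).
  exact: computable_proj.
have ct : computable (fun v : 2.-tuple nat => tnth v (lift ord0 ord0)).
  exact: computable_proj.
have ck := computable_comp1 computable1_block cx.
have cm := computable_comp1 computable1_pfst ck.
have cs := computable_comp1 computable1_psnd ck.
have cm1 := computable_succ cm.
apply: computable2_of_tuple; rewrite /flaws /=.
computable_arith => //.
- exact: (computable_comp2 cch).
- by apply: (computable_comp2 cch) => //; computable_arith.
- by apply: (computable_comp2 cg) => //; apply: (computable_comp2 computable2_modS).
Qed.

Lemma co_ce_spread (g : nat -> nat -> bool) :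
  computable2 (fun x s => g x s : nat) ->
  co_ce (spread g).
Proof. by move=> /computable2_flaws /co_ce_Pi1. Qed.

Section Limit.
Variables (g : nat -> nat -> bool) (a : nat -> bool).
Hypothesis ga : forall x, exists s0, forall s, s0 <= s -> g x s = a x.

Lemma changes_ev0 m : exists s0, forall s, s0 < s -> changes g m s = 0.
Proof.
elim: m => [|m [s1 H1]]; first by exists 0 => s _; rewrite /changes big_geq.
(* The strict inequality [s0 < s] matters: [s.-1] must also lie past the point where [g m] becomes
   constant. *)
have [s2 H2] := ga m; exists (maxn s1 s2) => s; rewrite gtn_max => /andP[l1 l2].
rewrite /changes big_nat_recr//= -/(changes _ _ _) H1// !H2 ?eqxx//; lia.
Qed.

(** Lower a stage after which nothing changes, one step at a time, until it is itself a stage of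
    change or 0. *)
Lemma settles_ex m : exists s, settles g m s.
Proof.
have [s0] := changes_ev0 m; elim: s0 => [|s0 IH] H.
  by exists 0; split=> [|t]; [left | exact: H].
have [e|/eqP ne] := eqVneq (changes g m s0.+1) 0.
  by apply: IH => s; rewrite leq_eqVlt => /predU1P[<-//|]; apply: H.
by exists s0.+1; split=> [|t]; [right | apply: H; lia].
Qed.

Lemma settles_limit m s i : settles g m s -> i < m -> g i s = a i.
Proof.
move=> [_ H] im; have [s0 H0] := ga i.
suff E t : g i (s + t) = g i s by rewrite -(E s0) H0 ?leq_addl.
elim: t => [|t <-]; first by rewrite addn0.
by rewrite addnS; have /changes_eq0/(_ _ im) := H t.
Qed.

(** Among the blocks with [pfst k < M], only finitely many are settled: a late block has a large
    guess [psnd k], at which the approximation below [M] no longer changes. This also disposes of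
    the repeated codes of [(m, 0)]. *)
Lemma settles_large M :
  exists k0, forall k, k0 <= k -> settles g (pfst k).+1 (psnd k) -> M <= pfst k.
Proof.
(* From this point on [isqrt k >= M + s0.+1], so that subtracting [pfst k < M] leaves
   [psnd k > s0]. *)
have [s0 H0] := changes_ev0 M; exists ((M + s0.+1) * (M + s0.+1)) => k kk.
move=> [st _]; rewrite leqNgt; apply/negP => lt.
have qk := isqrt_ge kk.
have ls : s0 < psnd k by rewrite /psnd; lia.
case: st => [st|]; first by move: ls; rewrite st.
apply; apply/changes_eq0 => i im; have /changes_eq0 := H0 _ ls; apply; lia.
Qed.

Definition count_below (P : nat -> bool) (m : nat) : nat :=
  \sum_(0 <= i < m) P i.

Lemma spread_blockT k j : bound k <= j <= bound k.+1 ->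
  settles g (pfst k).+1 (psnd k) ->
  count_below (fun x => x \in spread g) j =
  count_below (fun x => x \in spread g) (bound k) +
  \sum_(bound k <= x < j) a (x %% (pfst k).+1).
Proof.
move=> /andP[kj jk] st; rewrite /count_below (big_cat_nat (n := bound k))//=.
congr addn; apply: eq_big_nat => x /andP[kx xj].
have bx : block x = k by apply: block_eq; rewrite kx (leq_trans xj).
rewrite -(settles_limit st) ?ltn_pmod//; congr nat_of_bool.
apply/idP/idP => [/set_mem/spreadP|gx]; first by rewrite bx => -[].
by apply/mem_set/spreadP; rewrite bx.
Qed.

Lemma spread_blockF k j : bound k <= j <= bound k.+1 ->
  ~ settles g (pfst k).+1 (psnd k) ->
  count_below (fun x => x \in spread g) j =
  count_below (fun x => x \in spread g) (bound k).
Proof.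
move=> /andP[kj jk] st; rewrite /count_below (big_cat_nat (n := bound k))//=.
rewrite -[RHS]addn0; congr addn; rewrite big_nat big1// => x /andP[kx xj].
have bx : block x = k by apply: block_eq; rewrite kx (leq_trans xj).
by apply/eqP; rewrite eqb0; apply/negP => /set_mem/spreadP; rewrite bx => -[].
Qed.
End Limit.

(** * Comparison of the upper densities *)

Local Open Scope ring_scope.

(** The index [j] may depend on [k] in any way: since [M <= j], the value [v j] counts in
    [sups v M], whence [sups u N <= sups v M + e]. The bounds by 0 and 1 make these suprema, and the
    infimum over them, genuine. *)
Lemma le_limn_sup (R : realType) (u v : nat -> R) :
  (forall k, 0 <= u k <= 1) -> (forall k, 0 <= v k <= 1) ->
  (forall (e : R) M, 0 < e -> exists N, forall k, (N <= k)%N ->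
    exists2 j, (M <= j)%N & u k <= v j + e) ->
  limn_sup u <= limn_sup v.
Proof.
move=> u01 v01 H.
have bnd (w : nat -> R) :
    (forall k, 0 <= w k <= 1) -> bounded_fun (w : nat -> R^o).
  move=> w01; exists 1; split=> // x x1 k _ /=.
  by have /andP[w0 w1] := w01 k; rewrite ger0_norm// (le_trans w1)// ltW.
rewrite !limn_supE; try exact: bnd.
apply: lb_le_inf; first by exists (sups v 0); exists 0.
move=> _ [M _ <-]; apply/ler_addgt0Pr => e e0.
have [N HN] := H e M e0.
apply: (@le_trans _ _ (sups u N)).
  apply: ge_inf; last by exists N.
  by apply: bounded_fun_has_lbound_sups; exact: bnd.
apply: ge_sup; first by exists (u N); exists N => /=.
move=> _ [k /= Nk <-]; have [j Mj uv] := HN k Nk.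
apply: (le_trans uv); rewrite lerD2r; apply: ub_le_sup; last by exists j.
by apply: has_ubound_sdrop; exists 1 => _ [i _ <-]; have /andP[] := v01 i.
Qed.

(** * Densities of initial segments and of periodic sets *)

Section Density.
Variable R : realType.

Definition density (P : nat -> bool) (m : nat) : R :=
  (count_below P m)%:R / m%:R.

Lemma rhoE (X : set nat) m : rho R X m = density (fun x => x \in X) m.
Proof.
rewrite /rho /density /count_below; congr (_%:R / _).
rewrite -sum1_card big_mkcond big_mkord.
by apply: eq_bigr => i _; rewrite inE; case: ifP.
Qed.

Lemma count_below_le P m : (count_below P m <= m)%N.
Proof.
rewrite /count_below; elim: m => [|m IH]; first by rewrite big_geq.
by rewrite big_nat_recr//= -addn1 leq_add ?leq_b1.
Qed.

Lemma density01 P m : 0 <= density P m <= 1.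
Proof.
rewrite /density divr_ge0//=; case: m => [|m]; first by rewrite invr0 mulr0.
by rewrite ler_pdivrMr// mul1r ler_nat count_below_le.
Qed.

(** Removing one full period lowers both [p * m] and [count_below P m * j] by [count_below P m * m],
    so their difference is that of a remainder shorter than [m]. Two inequalities replace an
    absolute value because subtraction in [nat] is truncated. *)
Lemma periodic_count_nat (P : nat -> bool) (m j : nat) : (0 < m)%N ->
  let p := (\sum_(0 <= x < j) P (x %% m))%N in
  (p * m <= count_below P m * j + m * m)%N /\
  (count_below P m * j <= p * m + m * m)%N.
Proof.
move=> m0; elim/ltn_ind: j => j IH /=.
have cm := count_below_le P m.
case: (ltnP j m) => [jm|mj].
  (* For [j < m] both products are at most [m * m]. *)
  have := count_below_le (fun x => P (x %% m)%N) j.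
  by rewrite {1}/count_below; move: (\sum_(_ <= x < _) _)%N => p pj; nia.
rewrite -(subnKC mj); have [] := IH (j - m)%N; first by lia.
set q := (\sum_(0 <= x < _) _)%N.
rewrite (big_cat_nat (n := m)) ?leq_addr//=.
have -> : (\sum_(0 <= i < m) P (i %% m))%N = count_below P m.
  by apply: eq_big_nat => i /andP[_ im]; rewrite modn_small.
have -> : (\sum_(m <= i < m + (j - m)) P (i %% m))%N = q.
  rewrite -{1}[m]add0n big_addn addKn; apply: eq_big_nat => i _.
  by rewrite modnDr.
nia.
Qed.

Lemma periodic_count (P : nat -> bool) (m j : nat) : (0 < m)%N ->
  `|(\sum_(0 <= x < j) P (x %% m))%N%:R - density P m * j%:R| <= m%:R :> R.
Proof.
move=> m0; have [] := periodic_count_nat P j m0.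
move: (\sum_(_ <= x < _) _)%N => p.
have m0' : 0 < m%:R :> R by rewrite ltr0n.
have e : density P m * m%:R = (count_below P m)%:R by rewrite divfK// lt0r_neq0.
rewrite -!(ler_nat R) !natrD !natrM -e => h1 h2.
rewrite -(ler_pM2r m0') -{1}[m%:R]gtr0_norm// -normrM ler_norml; nra.
Qed.

(** The segment is the difference of two initial segments, each contributing an error of at most
    [m]. *)
Lemma periodic_count_seg (P : nat -> bool) (m i j : nat) :
  (0 < m)%N -> (i <= j)%N ->
  `|(\sum_(i <= x < j) P (x %% m))%N%:R - density P m * (j%:R - i%:R)|
    <= 2 * m%:R :> R.
Proof.
move=> m0 ij.
have := periodic_count P i m0; have := periodic_count P j m0.
rewrite (big_cat_nat (n := i))//= natrD !ler_norml; lra.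
Qed.

End Density.

(** * Density of the spread set, block by block *)

Section SpreadDensity.
Variables (R : realType) (g : nat -> nat -> bool) (a : nat -> bool).
Hypothesis ga : forall x, exists s0, forall s, (s0 <= s)%N -> g x s = a x.

Let c (j : nat) : R := (count_below (fun x => x \in spread g) j)%:R.

Definition block_density (k : nat) : R :=
  if `[< settles g (pfst k).+1 (psnd k) >] then density R a (pfst k).+1 else 0.

Lemma block_density01 k : 0 <= block_density k <= 1.
Proof.
by rewrite /block_density; case: ifP; rewrite ?lexx ?ler01// density01.
Qed.

(** The period in block [k] is [(pfst k).+1 <= k.+1], which bounds the error independently of
    [j]. *)
Lemma count_block k j : (bound k <= j <= bound k.+1)%N ->
  `|c j - c (bound k) - block_density k * (j%:R - (bound k)%:R)|
    <= 2 * k.+1%:R.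
Proof.
move=> kj; have /andP[kj1 _] := kj; rewrite /block_density.
case: asboolP => st; last first.
  have -> : c j = c (bound k) by rewrite /c (spread_blockF kj st).
  by rewrite mul0r subrr subr0 normr0 mulr_ge0.
have -> : c j =
    c (bound k) + (\sum_(bound k <= x < j) a (x %% (pfst k).+1))%N%:R.
  by rewrite /c (spread_blockT ga kj st) natrD.
rewrite [c _ + _]addrC addrK.
apply: le_trans (periodic_count_seg _ _ _ _) _ => //.
by rewrite ler_pM2l// ler_nat ltnS pfst_le.
Qed.

(** Two blocks enter because [j] may lie just past [bound k.+1], where block [k] still dominates.
    Everything before block [k] is counted in full, at the cost of [bound k <= j / k.+1]. The
    periodic errors [2 * k.+1 + 2 * k.+2] are at most [6 * k.+1], hence at most [6 * j / k.+1] as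
    [k.+1 * k.+1 <= j]. Together they give the 7. *)
Lemma spread_density_ub k j : (bound k.+1 <= j <= bound k.+2)%N ->
  density R (fun x => x \in spread g) j
    <= Num.max (block_density k) (block_density k.+1) + 7 / k.+1%:R.
Proof.
move=> kj; have /andP[kj1 _] := kj.
have B1 := ltnW (bound_lt k).
have := count_block kj; have := @count_block k (bound k.+1).
rewrite B1 leqnn => /(_ isT); rewrite !ler_norml => /andP[_ h1] /andP[_ h2].
have c0 : c (bound k) <= (bound k)%:R by rewrite ler_nat count_below_le.
have s1 : (k.+1 * k.+1)%:R <= j%:R :> R.
  by rewrite ler_nat (leq_trans (bound_sqr _)).
have s2 : (k.+1 * bound k)%:R <= j%:R :> R.
  by rewrite ler_nat (leq_trans (bound_mul _)).
have j0 : 0 < j%:R :> R by apply: lt_le_trans s1; rewrite ltr0n.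
have k0 : 0 < k.+1%:R :> R by rewrite ltr0n.
rewrite /density -/(c j) ler_pdivrMr//.
set d := Num.max _ _.
have d1 : block_density k <= d by rewrite le_max lexx.
have d2 : block_density k.+1 <= d by rewrite le_max lexx orbT.
have b1 : 0 <= (bound k.+1)%:R - (bound k)%:R :> R by rewrite subr_ge0 ler_nat.
have b2 : 0 <= j%:R - (bound k.+1)%:R :> R by rewrite subr_ge0 ler_nat.
have d0 : 0 <= d by apply: le_trans d1; have /andP[] := block_density01 k.
have bk0 : 0 <= (bound k)%:R :> R by [].
have e1 := ler_wpM2r b1 d1.
have e2 := ler_wpM2r b2 d2.
have e3 := mulr_ge0 d0 bk0.
have e4 : c j <= d * j%:R + ((bound k)%:R + 2 * k.+1%:R + 2 * k.+2%:R).
  lra.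
apply: (le_trans e4); rewrite [leRHS]mulrDl lerD2l.
rewrite mulrAC ler_pdivlMr// -[k.+2]addn1 natrD.
move: s1 s2; rewrite !natrM.
have : 1 <= k.+1%:R :> R by rewrite ler1n.
nra.
Qed.

(** At the end of block [k], neglecting the earlier blocks costs at most [bound k], a proportion of
    at most [1 / k.+1], and the periodic error [2 * k.+1] a proportion of at most [2 / k.+1]. *)
Lemma spread_density_lb k :
  block_density k - 3 / k.+1%:R
    <= density R (fun x => x \in spread g) (bound k.+1).
Proof.
have B1 := ltnW (bound_lt k).
have := @count_block k (bound k.+1).
rewrite B1 leqnn => /(_ isT); rewrite ler_norml => /andP[h1 _].
have c0 : 0 <= c (bound k) by [].
have s1 : (k.+1 * k.+1)%:R <= (bound k.+1)%:R :> R by rewrite ler_nat bound_sqr.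
have s2 : (k.+1 * bound k)%:R <= (bound k.+1)%:R :> R.
  by rewrite ler_nat bound_mul.
have j0 : 0 < (bound k.+1)%:R :> R by apply: lt_le_trans s1; rewrite ltr0n.
have k0 : 0 < k.+1%:R :> R by rewrite ltr0n.
rewrite /density -/(c _) ler_pdivlMr// mulrBl lerBlDr.
have /andP[d0 d1] := block_density01 k.
have bk0 : 0 <= (bound k)%:R :> R by [].
have e1 := ler_wpM2r bk0 d1.
have e2 : block_density k * (bound k.+1)%:R <=
    c (bound k.+1) + ((bound k)%:R + 2 * k.+1%:R).
  lra.
apply: (le_trans e2); rewrite lerD2l mulrAC ler_pdivlMr//.
move: s1 s2; rewrite !natrM; nra.
Qed.

(** A settled late block carries a density of [a] at a large index, by [settles_large]. An unsettled
    one has density 0, which any index dominates. *)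
Lemma block_density_ub M : exists k0, forall k, (k0 <= k)%N ->
  exists2 i, (M <= i)%N & block_density k <= density R a i.+1.
Proof.
have [k0 H] := settles_large ga M; exists k0 => k /H{}H.
rewrite /block_density; case: asboolP => st; first by exists (pfst k); rewrite ?H.
by exists M; rewrite ?leqnn//; have /andP[] := density01 R a M.+1.
Qed.

Lemma block_density_surj m :
  exists2 k, (m <= k)%N & block_density k = density R a m.+1.
Proof.
have [s st] := settles_ex ga m.+1; have [k [mk k1 k2]] := unpair_surj m s.
by exists k => //; rewrite /block_density k1 k2; case: asboolP.
Qed.

Lemma ratio_small (C e : R) : 0 < C -> 0 < e ->
  exists N, forall k, (N <= k)%N -> C / k.+1%:R <= e.
Proof.
move=> C0 e0; exists (Num.truncn (C / e)) => k Nk.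
rewrite ler_pdivrMr ?ltr0n// mulrC -ler_pdivrMr//.
apply: ltW; apply: lt_le_trans (truncnS_gt _) _.
by rewrite ler_nat ltnS.
Qed.

Lemma le_limn_sup_spread :
  limn_sup (fun k => density R (fun x => x \in spread g) k.+1)
    <= limn_sup (fun k => density R a k.+1).
Proof.
apply: le_limn_sup => [k|k|e M e0]; [exact: density01|exact: density01|].
have [N1 H1] := block_density_ub M.
have [N2 H2] : exists N, forall k, (N <= k)%N -> 7 / k.+1%:R <= e.
  by apply: ratio_small => //.
(* Past this bound the block of [j.+1] has index at least [(maxn N1 N2).+2], so the preceding block
   [k], which also enters the estimate, still lies beyond [N1] and [N2]. *)
exists (bound (maxn N1 N2).+2) => j jk.
have /andP[bj1 bj2] := blockP j.+1.
have : (maxn N1 N2 < (block j.+1).-1)%N.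
  have [le|lt] := leqP (block j.+1) (maxn N1 N2).+1; last by lia.
  have := leq_trans bj2 (@bound_le (block j.+1).+1 (maxn N1 N2).+2 le).
  by rewrite ltnNge (leqW jk).
case: (block j.+1) bj1 bj2 => [//|k] bj1 bj2 /= lk.
have := @spread_density_ub k j.+1; rewrite bj1 ltnW// => /(_ isT) ub.
have [|i1 Mi1 bi1] := H1 k; first lia.
have [|i2 Mi2 bi2] := H1 k.+1; first lia.
have := H2 k; move=> /(_ ltac:(lia)) ek.
case: (leP (block_density k) (block_density k.+1)) ub => _ ub.
  by exists i2 => //; apply: le_trans ub _; apply: lerD.
by exists i1 => //; apply: le_trans ub _; apply: lerD.
Qed.

Lemma ge_limn_sup_spread :
  limn_sup (fun k => density R a k.+1) <=
  limn_sup (fun k => density R (fun x => x \in spread g) k.+1).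
Proof.
apply: le_limn_sup => [k|k|e M e0]; [exact: density01|exact: density01|].
have [N HN] : exists N, forall k, (N <= k)%N -> 3 / k.+1%:R <= e.
  by apply: ratio_small => //.
exists (maxn M N) => m; rewrite geq_max => /andP[Mm Nm].
(* The density of [a] below [m.+1] reappears, up to [3 / k.+1], at the end of a settled block
   [k >= m]. The index wanted is [j = bound k.+1 - 1], at least [M] because
   [bound k.+1 >= k.+1 * k.+1]. *)
have [k mk <-] := block_density_surj m.
have := bound_sqr k.+1; have := spread_density_lb k.
have := HN k (leq_trans Nm mk).
case: (bound k.+1) => [|j] h1 h2 h3; first by [].
exists j; first by nia.
by rewrite -lerBlDr; apply: le_trans h2; rewrite lerD2l lerN2.
Qed.

End SpreadDensity.

Lemma upper_density_spread (R : realType) (A : set nat)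
    (g : nat -> nat -> bool) :
  (forall x, exists s0, forall s, (s0 <= s)%N -> g x s = (x \in A)) ->
  upper_density R (spread g) = upper_density R A.
Proof.
move=> gA; rewrite /upper_density.
under [in LHS]eq_fun do rewrite rhoE; under [in RHS]eq_fun do rewrite rhoE.
by apply/le_anti; rewrite le_limn_sup_spread// ge_limn_sup_spread.
Qed.

Local Close Scope ring_scope.

(** * Passing between n-c.e. and co-c.e. sets *)

Lemma cvg_bool_eventually (u : nat -> bool) (b : bool) :
  u s @[s --> \oo] --> b -> exists s0, forall s, s0 <= s -> u s = b.
Proof. by move=> /discrete_cvg [N _ HN]; exists N => s /HN. Qed.

Lemma n_ce_co_ce (R : realType) n (A : set nat) :
  n_ce n A -> exists B, co_ce B /\ upper_density R B = upper_density R A.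
Proof.
move=> [g [cg gP]]; exists (spread g); split; first exact: co_ce_spread.
apply: upper_density_spread => x; have [_ gx _] := gP x.
exact: cvg_bool_eventually gx.
Qed.

Lemma co_ceP (A : set nat) :
  co_ce A <-> exists2 N, computable2 N & A = [set x | forall t, N x t = 0].
Proof.
split=> [|[N cN ->]]; last exact: co_ce_Pi1.
move=> [A0|[f [cf Af]]].
  exists (fun _ _ => 0); first exact/computable2_of_tuple/computable_const.
  by rewrite -[A]setCK A0 setC0; apply/seteqP; split.
exists (fun x t => f t == x).
  apply: computable2_of_tuple.
  apply: (computable_ext (F := fun v : 2.-tuple nat =>
    1 - (f (tnth v (lift ord0 ord0)) != tnth v ord0))).
    by move=> v; case: eqP.
  by computable_arith; apply: (computable_comp1 cf); computable_arith.
rewrite -[A]setCK Af; apply/seteqP; split=> x /=.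
  by move=> nx t; apply/eqP; rewrite eqb0; apply/eqP => e; apply: nx; exists t.
by move=> H [t _ e]; have := H t; rewrite e eqxx.
Qed.

(** Put every [x] into the set at stage 1, and remove it for good once a witness against it appears:
    at most two changes. The partial sums [h x s] of [N x] are nondecreasing in [s], so they record
    whether a witness has been seen. *)
Lemma co_ce_n_ce n (A : set nat) : 2 <= n -> co_ce A -> n_ce n A.
Proof.
move=> n2 /co_ceP[N cN AE].
pose h x s := \sum_(0 <= i < s) N x i.
have hS x s : h x s.+1 = h x s + N x s by rewrite /h big_nat_recr.
have hle x s t : s <= t -> h x s <= h x t.
  by move/subnKC <-; elim: (t - s) => [|d IH]; rewrite ?addn0// addnS hS; lia.
have AP x : (x \in A) = `[< forall s, h x s = 0 >].
  rewrite AE; apply/idP/asboolP => [/set_mem H s|H]; first by rewrite /h big1.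
  apply/mem_set => t.
  by have := H t.+1; rewrite hS; lia.
exists (fun x s => (0 < s) && (h x s == 0)); split.
  have ch : computable2 (fun s x => h x s).
    apply: (computable2_sum (F := fun i x => N x i)).
    apply: computable2_of_tuple.
    by apply: (computable_comp2 cN); apply: computable_proj.
  apply: computable2_of_tuple.
  apply: (computable_ext (F := fun v : 2.-tuple nat =>
    (0 < tnth v (lift ord0 ord0)) *
    (h (tnth v ord0) (tnth v (lift ord0 ord0)) <= 0))).
    by move=> v; rewrite leqn0; case: (_ < _); case: (_ == 0).
  by computable_arith; apply: (computable_comp2 ch); apply: computable_proj.
move=> x; split=> //.
  apply/discrete_cvg.
  have [H|/existsNP[s0 Hs]] := pselect (forall s, h x s = 0).
    exists 1 => // s /= s1; rewrite AP H s1 eqxx; apply/esym/asboolP/H.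
  exists s0 => // s /= s1; rewrite AP (_ : h x s == 0 = false) ?andbF.
    by apply/esym/asboolP => H; apply: Hs.
  by apply/eqP; have := hle x _ _ s1; lia.
apply: card_le_trans (_ : `I_2 #<= _)%card; last by rewrite card_le_II.
(* Stage 0 is sent to 0 and all later stages of change to 1. This is injective since at most one
   change occurs after stage 0. *)
apply/pcard_leP/injfunPex; exists (fun s => (s != 0) : nat).
  by move=> s _ /=; case: (s != 0).
move=> s t /set_mem /= Hs /set_mem /= Ht.
case: s Hs => [|s]; case: t Ht => [|t] //= Ht Hs _.
(* A change at a positive stage means that [h x] leaves 0, which by monotonicity happens only once.
   Applying [E] in both directions identifies the two stages. *)
have E s1 s2 : h x s1.+1 == 0 <> (h x s1.+2 == 0) ->
    h x s2.+1 == 0 <> (h x s2.+2 == 0) -> s1 <= s2.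
  move=> E1 E2; rewrite leqNgt; apply/negP => lt.
  have := hle x s2.+2 s1.+1 lt; have := hle x s1.+1 s1.+2 (leqnSn _).
  have := hle x s2.+1 s2.+2 (leqnSn _).
  move: E1 E2; do 4 case: eqP => //; lia.
by congr _.+1; apply/eqP; rewrite eqn_leq !E.
Qed.

Theorem corollary6p2 (R : realType) (r : R) (hr0 : (0 <= r)%R) (hr1 : (r <= 1)%R)
    (n : nat) (hn : (2 <= n)%N) :
  (exists A : set nat, n_ce n A /\ upper_density R A = r) <->
  (exists A : set nat, co_ce A /\ upper_density R A = r).
Proof.
split=> [[A [/(n_ce_co_ce R)[B [cB <-]] <-]]|[A [cA <-]]]; first by exists B.
by exists A; split=> //; apply: co_ce_n_ce.
Qed.
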